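(* Suppose $\Gamma$ is a hyperbolic metric graph and the barycenter map $\partial^3\Gamma\to\Gamma$ is coarsely surjective. Moreover, suppose that the graph $\Gamma$ has bounded valence. Then $\Gamma$ has exponential growth.
   Context: A graph is a connected $1$-dimensional CW complex in which no edge forms a loop; a metric graph is a graph in which every edge has length $1$ (with its path metric). The valence at a vertex is the number of edges adjacent to it; $\Gamma$ has bounded valence if there is a constant bounding the valence at every vertex (in particular $\Gamma$ is then a proper metric space). Hyperbolic means Gromov hyperbolic. A map $\phi:Y\to Z$ is coarsely surjective if for some $L\ge0$ every point of $Z$ is within distance $L$ of $\phi(Y)$. Barycenter map. For a proper $\delta$-hyperbolic geodesic space $W$ with geodesic boundary $\partial W$, let $\partial^3W$ be the set of triples of pairwise distinct points of $\partial W$. There are constants $D_0(\delta),R_0(\delta)\ge0$ such that for each $(\xi_1,\xi_2,\xi_3)\in\partial^3W$ there is a point of $W$ (a barycenter) within $D_0(\delta)$ of every geodesic line joining $\xi_i$ and $\xi_j$, $i\ne j$, and any two such points are at distance at most $R_0(\delta)$. A barycenter map $\partial^3W\to W$ sends each triple to a chosen barycenter. Exponential growth. For a vertex $u$ of $\Gamma$ and $n\in\mathbb N$ ($n\ge1$), $B(u,n)=\{v\in\Gamma: d_\Gamma(u,v)\le n\}$ and $\|B(u,n)\|$ is the number of vertices in it. A metric graph $\Gamma$ of bounded valence has exponential growth if there are $a>0$, $b>1$ with $\|B(u,n)\|\ge ab^n$ for every vertex $u$ of $\Gamma$ and every $n\in\mathbb N$. *)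

(* Defs.v *)
From HB Require Import structures.
From mathcomp Require Import all_boot all_order all_algebra finmap.
From mathcomp Require Import generic_quotient lra.
From mathcomp Require Import all_classical all_reals all_analysis.

Set Implicit Arguments.
Unset Strict Implicit.
Unset Printing Implicit Defensive.

Import Order.TTheory GRing.Theory Num.Theory.

Local Open Scope classical_set_scope.
Local Open Scope card_scope.
Local Open Scope quotient_scope.
Local Open Scope ring_scope.

(* Graphs may have multiple edges, and need not be locally finite.  The
   orientation given by [src] and [tgt] only serves to parametrize edges. *)

Definition joined_by_edge (V E : choiceType) (src tgt : E -> V) : rel V :=
  fun u v => `[< exists e, (src e = u /\ tgt e = v) \/
                           (src e = v /\ tgt e = u) >].

Record graph := Graph {
  vertex : choiceType;
  edge : choiceType;
  src : edge -> vertex;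
  tgt : edge -> vertex;
  no_loop : forall e, src e != tgt e;
  graph_connected : forall u v : vertex,
    exists2 p : seq vertex, path (joined_by_edge src tgt) u p & last u p = v
}.

Definition bounded_valence (G : graph) :=
  exists N : nat, forall v : vertex G,
    [set e : edge G | src e = v \/ tgt e = v] #<= `I_N.

(* The points of the CW complex: its vertices, and the open edges ]0, 1[. *)
Definition realization (R : realType) (G : graph) : Type :=
  (vertex G + edge G * {t : R | 0 < t < 1})%type.

HB.instance Definition _ (R : realType) (G : graph) :=
  Choice.copy (realization R G)
    (vertex G + edge G * {t : R | 0 < t < 1})%type.

Section PathMetric.
Variables (R : realType) (G : graph).
Local Notation X := (realization R G).

Definition vertex_point (v : vertex G) : X := inl v.

(* The characteristic map [0, 1] -> X of the edge e (the values for t outside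
   of [0, 1] are irrelevant). *)
Definition edge_point (e : edge G) (t : R) : X :=
  if insub t is Some u then inr (e, u)
  else vertex_point (if t <= 0 then src e else tgt e).

(* [polyline x y l]: there is a piecewise linear path of length l from x to y,
   i.e., a concatenation of finitely many segments, each contained in a closed
   edge of length 1. *)
Inductive polyline : X -> X -> R -> Prop :=
| polyline_nil x : polyline x x 0
| polyline_cons e s t y l : 0 <= s <= 1 -> 0 <= t <= 1 ->
    polyline (edge_point e t) y l ->
    polyline (edge_point e s) y (`|s - t| + l).

Definition path_dist (x y : X) : R := inf [set l | polyline x y l].

Lemma edge_point0 e : edge_point e 0 = vertex_point (src e).
Proof. by rewrite /edge_point insubN ?ltxx//= lexx. Qed.

Lemma edge_point1 e : edge_point e 1 = vertex_point (tgt e).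
Proof. by rewrite /edge_point insubN ?ltxx ?andbF//= ler10. Qed.

Lemma edge_point_inner e (u : {t : R | 0 < t < 1}) :
  edge_point e (val u) = inr (e, u).
Proof. by rewrite /edge_point valK. Qed.

Lemma polyline_ge0 x y l : polyline x y l -> 0 <= l.
Proof. by elim=> // *; rewrite addr_ge0. Qed.

Lemma polyline_cat x y z l m :
  polyline x y l -> polyline y z m -> polyline x z (l + m).
Proof.
move=> xy; elim: xy z m => [x0 z m|e s t y0 l0 s01 t01 _ IH z m yz].
  by rewrite add0r.
by rewrite -addrA; apply: polyline_cons => //; exact: IH.
Qed.

Lemma polyline_segment e s t : 0 <= s <= 1 -> 0 <= t <= 1 ->
  polyline (edge_point e s) (edge_point e t) `|s - t|.
Proof.
by move=> s01 t01; rewrite -(addr0 `|s - t|); apply: polyline_cons => //; constructor.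
Qed.

Lemma polyline_sym x y l : polyline x y l -> polyline y x l.
Proof.
elim=> [x0|e s t y0 l0 s01 t01 _ IH]; first by constructor.
by rewrite addrC; apply: (polyline_cat IH); rewrite distrC; exact: polyline_segment.
Qed.

Lemma polyline_to_vertex x : exists v l, polyline x (vertex_point v) l.
Proof.
case: x => [v|[e u]]; first by exists v, 0; constructor.
exists (src e), `|val u - 0|; rewrite -edge_point0 -edge_point_inner.
have /andP[u0 u1] := valP u.
by apply: polyline_segment; rewrite ?lexx ?ler01// !ltW.
Qed.

Lemma polyline_vertices u v :
  exists l, polyline (vertex_point u) (vertex_point v) l.
Proof.
have [p + <-] := graph_connected u v.
elim: p u => [|w p IH] u /=; first by exists 0; constructor.
case/andP=> /asboolP[e euw] /IH[l wl].
have [m um] : exists m, polyline (vertex_point u) (vertex_point w) m.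
  have h := @polyline_segment e 0 1 ltac:(by rewrite lexx ler01)
    ltac:(by rewrite lexx ler01).
  exists `|0 - 1|; case: euw => -[<- <-]; rewrite -edge_point0 -edge_point1 //.
  exact: polyline_sym.
by exists (m + l); exact: polyline_cat wl.
Qed.

Lemma polyline_exists x y : exists l, polyline x y l.
Proof.
have [u [l xu]] := polyline_to_vertex x.
have [v [m yv]] := polyline_to_vertex y.
have [k uv] := polyline_vertices u v.
exists (l + (k + m)); apply: polyline_cat xu _.
by apply: polyline_cat uv _; exact: polyline_sym.
Qed.

Lemma path_dist_le x y l : polyline x y l -> path_dist x y <= l.
Proof. by move=> xy; apply: ge_inf => //; exists 0 => m /polyline_ge0. Qed.

Lemma le_path_dist x y c :
  (forall l, polyline x y l -> c <= l) -> c <= path_dist x y.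
Proof. by move=> h; apply: lb_le_inf; [exact: polyline_exists|]. Qed.

Lemma path_distxx x : path_dist x x = 0.
Proof.
apply/eqP; rewrite eq_le (path_dist_le (polyline_nil x))/=.
by apply: le_path_dist => l /polyline_ge0.
Qed.

Lemma path_dist_sym x y : path_dist x y = path_dist y x.
Proof.
by apply/eqP; rewrite eq_le; apply/andP; split; apply: le_path_dist => l ?;
  apply: path_dist_le; exact: polyline_sym.
Qed.

Lemma path_dist_triangle y x z :
  path_dist x z <= path_dist x y + path_dist y z.
Proof.
rewrite -lerBlDr; apply: le_path_dist => l xy; rewrite lerBlDr -lerBlDl.
apply: le_path_dist => m yz; rewrite lerBlDl.
by apply: path_dist_le; exact: polyline_cat yz.
Qed.

Lemma lipschitz_path_dist (f : X -> R) :
  (forall e s t, 0 <= s <= 1 -> 0 <= t <= 1 ->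
     `|f (edge_point e s) - f (edge_point e t)| <= `|s - t|) ->
  forall x y, `|f x - f y| <= path_dist x y.
Proof.
move=> fL x y; apply: le_path_dist => l; elim=> [z|e s t z m s01 t01 _ IH].
  by rewrite subrr normr0.
by rewrite (le_trans (ler_distD (f (edge_point e t)) _ _))// lerD// fL.
Qed.

Lemma edge_pointP e (t : R) : 0 <= t <= 1 ->
  [\/ t = 0 /\ edge_point e t = vertex_point (src e),
      t = 1 /\ edge_point e t = vertex_point (tgt e) |
      exists2 u : {t : R | 0 < t < 1}, val u = t & edge_point e t = inr (e, u)].
Proof.
case/andP; rewrite le_eqVlt => /predU1P[<- _|t0].
  by constructor 1; rewrite edge_point0.
rewrite le_eqVlt => /predU1P[->|t1]; first by constructor 2; rewrite edge_point1.
have t01 : 0 < t < 1 by rewrite t0.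
by constructor 3; exists (exist _ t t01) => //; rewrite -edge_point_inner.
Qed.

Lemma path_dist_positivity x y : path_dist x y = 0 -> x = y.
Proof.
case: x => [v|[e0 u0]] d0.
- pose g e t : R := if src e == v then t else if tgt e == v then 1 - t else 1.
  pose f (p : X) : R := match p with
    | inl w => if w == v then 0 else 1
    | inr (e, u) => g e (val u) end.
  have fE e t : 0 <= t <= 1 -> f (edge_point e t) = g e t.
    rewrite /g; case/(@edge_pointP e) => [[-> ->]|[-> ->]|[u <- ->//]] /=.
      case: ifP => // sv; case: ifP => //; lra.
    case: (eqVneq (src e) v) => [sv|_]; last by case: ifP => //; lra.
    by have := no_loop e; rewrite sv eq_sym => /negbTE ->.
  have : `|f (inl v) - f y| <= 0.
    apply: (le_trans (lipschitz_path_dist _ _ _)); last by rewrite d0.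
    move=> e s t s01 t01.
    rewrite !fE// /g; case: ifP => // _; case: ifP => _.
      by rewrite opprB addrC addrA subrK distrC.
    by rewrite subrr normr0.
  rewrite normr_le0 subr_eq0 /= eqxx.
  case: y {d0} => [w|[e u]] /=.
    case: (eqVneq w v) => [->//|_] /eqP h; exfalso; lra.
  have /andP[/= u0 u1] := valP u; rewrite /g /=.
  case: ifP => _; [|case: ifP => _] => /eqP h; exfalso; lra.
- have /andP[u0gt0 u0lt1] := valP u0.
  pose t0 : R := val u0; pose eps : R := Num.min t0 (1 - t0).
  pose g e t : R := if e == e0 then Num.min eps `|t - t0| else eps.
  pose f (p : X) : R := match p with
    | inl _ => eps
    | inr (e, u) => g e (val u) end.
  have eps0 : 0 < eps by rewrite lt_min; apply/andP; split; rewrite /t0; lra.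
  have fE e t : 0 <= t <= 1 -> f (edge_point e t) = g e t.
    rewrite /g; case/(@edge_pointP e) => [[-> ->]|[-> ->]|[u <- ->//]] /=;
      case: ifP => // _; apply/esym/min_idPl; rewrite ge_min.
      by rewrite sub0r normrN ger0_norm ?lexx// ltW.
    by rewrite ger0_norm ?lexx ?orbT// subr_ge0 ltW.
  have : `|f (inr (e0, u0)) - f y| <= 0.
    apply: (le_trans (lipschitz_path_dist _ _ _)); last by rewrite d0.
    move=> e s t s01 t01.
    rewrite !fE// /g; case: ifP => _; last by rewrite subrr normr0.
    have min_lip (c a b : R) : `|Num.min c a - Num.min c b| <= `|a - b|.
      have := ler_norm (a - b); have := lerNnormlW (lexx `|a - b|).
      by rewrite ler_norml; case: (leP c a) => ?; case: (leP c b) => ? ? ?;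
        apply/andP; split; lra.
    have st : `|s - t| = `|(s - t0) - (t - t0)| by congr `|_|; lra.
    by rewrite st (le_trans (min_lip _ _ _))// ler_dist_dist.
  rewrite normr_le0 subr_eq0 /= /g eqxx /t0 subrr normr0.
  rewrite [Num.min eps 0]min_r ?ltW//.
  case: y {d0} => [w|[e u]] /=; first by move=> /eqP h; exfalso; lra.
  rewrite /g; case: (eqVneq e e0) => [->|_]; last by move=> /eqP h; exfalso; lra.
  rewrite minEle; case: ifP => _; first by move=> /eqP h; exfalso; lra.
  by rewrite eq_sym normr_eq0 subr_eq0 => /eqP/val_inj->.
Qed.

HB.instance Definition _ := @isMetric.Build R X path_dist path_distxx
  path_dist_positivity path_dist_sym path_dist_triangle.

End PathMetric.

Section HyperbolicGeometry.
Variables (R : realType) (X : metricType R).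

Definition gromov_product (w x y : X) : R :=
  (mdist x w + mdist y w - mdist x y) / 2.

Definition delta_hyperbolic (delta : R) := forall w x y z : X,
  Num.min (gromov_product w x y) (gromov_product w y z) - delta
    <= gromov_product w x z.

Definition gromov_hyperbolic := exists2 delta : R, 0 <= delta &
  delta_hyperbolic delta.

(* Only the restriction to [0, +oo[ of the underlying function matters. *)
Record geodesic_ray := GeodesicRay {
  ray_fun :> R -> X;
  ray_isometric : forall s t, 0 <= s -> 0 <= t ->
    mdist (ray_fun s) (ray_fun t) = `|s - t|
}.

HB.instance Definition _ := gen_eqMixin geodesic_ray.
HB.instance Definition _ := gen_choiceMixin geodesic_ray.

Definition asymptotic : rel geodesic_ray := fun c c' =>
  `[< exists K : R, forall t, 0 <= t -> mdist (c t) (c' t) <= K >].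

Lemma asymptotic_refl : reflexive asymptotic.
Proof. by move=> c; apply/asboolP; exists 0 => t _; rewrite mdistxx. Qed.

Lemma asymptotic_sym : symmetric asymptotic.
Proof.
by move=> c c'; apply/asboolP/asboolP => -[K cK]; exists K => t t0;
  rewrite metric_sym; exact: cK.
Qed.

Lemma asymptotic_trans : transitive asymptotic.
Proof.
move=> c2 c1 c3 /asboolP[K cK] /asboolP[L cL]; apply/asboolP; exists (K + L).
by move=> t t0; rewrite (le_trans (metric_triangle _ (c2 t) _))// lerD ?cK ?cL.
Qed.

Canonical asymptotic_equiv :=
  EquivRel asymptotic asymptotic_refl asymptotic_sym asymptotic_trans.

Definition geodesic_boundary := {eq_quot asymptotic_equiv}.

Definition endpoint (c : geodesic_ray) : geodesic_boundary :=
  \pi_geodesic_boundary c.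

Record geodesic_line := GeodesicLine {
  line_fun :> R -> X;
  line_isometric : forall s t, mdist (line_fun s) (line_fun t) = `|s - t|
}.

Definition positive_ray (c : geodesic_line) : geodesic_ray :=
  @GeodesicRay c (fun s t _ _ => line_isometric c s t).

Lemma negative_ray_isometric (c : geodesic_line) s t : 0 <= s -> 0 <= t ->
  mdist (c (- s)) (c (- t)) = `|s - t|.
Proof. by move=> _ _; rewrite line_isometric -opprD normrN. Qed.

Definition negative_ray (c : geodesic_line) : geodesic_ray :=
  GeodesicRay (@negative_ray_isometric c).

Definition line_joins (c : geodesic_line) (xi eta : geodesic_boundary) :=
  endpoint (negative_ray c) = xi /\ endpoint (positive_ray c) = eta.

Record ideal_triple := IdealTriple {
  triple_fun :> 'I_3 -> geodesic_boundary;
  triple_inj : injective triple_fun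
}.

Definition is_barycenter (D : R) (xi : ideal_triple) (p : X) :=
  forall (i j : 'I_3) (c : geodesic_line),
    i != j -> line_joins c (xi i) (xi j) -> exists t, mdist p (c t) <= D.

(* The constant D is left existential: in a proper hyperbolic geodesic space
   two points [p] and [q] that are barycenters of the same triple, for possibly
   different constants, are at uniformly bounded distance. *)
Definition barycenter_map (b : ideal_triple -> X) :=
  exists2 D : R, 0 <= D & forall xi, is_barycenter D xi (b xi).

Definition coarsely_surjective (Y : Type) (phi : Y -> X) :=
  exists2 L : R, 0 <= L & forall z, exists y, mdist z (phi y) <= L.

End HyperbolicGeometry.

Section Growth.
Variables (R : realType) (G : graph).

Definition vertex_ball (u : vertex G) (n : nat) : set (vertex G) :=
  [set v | mdist (vertex_point R u) (vertex_point R v) <= n%:R].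

(* Balls are finite when [G] has bounded valence; [fset_set] sends infinite
   sets to [fset0]. *)
Definition exponential_growth :=
  exists a b : R, [/\ 0 < a, 1 < b &
    forall (u : vertex G) (n : nat), (0 < n)%N ->
      a * b ^+ n <= #|` fset_set (vertex_ball u n)|%:R].

End Growth.

(* Main.v *)
Require Import Defs.
From mathcomp Require Import all_boot all_order all_algebra finmap.
From mathcomp Require Import generic_quotient lra zify.
From mathcomp Require Import all_classical all_reals all_analysis.

Set Implicit Arguments.
Unset Strict Implicit.
Unset Printing Implicit Defensive.

Import Order.TTheory GRing.Theory Num.Theory.

Local Open Scope classical_set_scope.
Local Open Scope quotient_scope.
Local Open Scope ring_scope.

(** Write (x|y)_w for the Gromov product. It is, up to an additive constant, the
time for which geodesics from w to x and to y stay together, and hyperbolicity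
makes it behave like an ultrametric.

The boundary enters only to show that the graph branches everywhere at a
uniform scale. A vertex u is near the barycenter of some ideal triple, hence
near geodesic lines joining the three ideal points pairwise. Far out on rays to
the three ideal points the pairwise products seen from u are then at most a
constant C depending on neither u nor the triple; cutting geodesics towards
these far points at distance N from u only decreases products
([three_directions]). So at each vertex, and for every N, there are three
vertices at distance N with pairwise products at most C.

Being a barycenter is a condition on the lines joining the ideal points, which
says nothing unless such lines exist. Their existence rests on the finiteness
of balls ([line_joining_boundary]): shortest walks between far points of two
non-asymptotic rays pass within a bounded distance of a fixed vertex, and
converge along an ultrafilter to a bi-infinite geodesic, which hyperbolicity
forces to follow both rays.

Now fix N large with respect to C and grow a tree. On arriving at a vertex from
a previous one, at most one of the three directions turns back, so two of them
make an almost straight continuation ([two_children]). A path made of long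
steps with small backtracking never closes up, so the 2 ^ k branches of length
k * N end at distinct vertices ([binary_tree]), and balls grow at least like
powers of the N-th root of 2 ([growth_of_trees]). *)

(** * Gromov products *)

Section GromovProduct.
Variables (R : realType) (X : metricType R).
Implicit Types w x y z : X.
Local Notation gp := (@gromov_product R X).

Lemma gromov_productC w x y : gp w x y = gp w y x.
Proof. by rewrite /gromov_product (metric_sym x y) (addrC (mdist x w)). Qed.

Lemma gromov_product_base w x : gp w w x = 0.
Proof. by rewrite /gromov_product mdistxx (metric_sym w x); lra. Qed.

Lemma gromov_product_move_base w w' x y : gp w x y <= gp w' x y + mdist w w'.
Proof.
rewrite /gromov_product.
have := metric_triangle x w' w; have := metric_triangle y w' w.
by rewrite (metric_sym w' w); lra.
Qed.

Lemma gromov_product_move w x x' y : gp w x y <= gp w x' y + mdist x x'.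
Proof.
rewrite /gromov_product.
have := metric_triangle x x' w; have := metric_triangle x' x y.
by rewrite (metric_sym x' x); lra.
Qed.

(** Products decrease when a point is pulled towards the base along a geodesic.
This is a plain triangle inequality, so no constant is lost. *)
Lemma gromov_product_segment w x z y :
  mdist z w = mdist z x + mdist x w -> gp w x y <= gp w z y.
Proof. by rewrite /gromov_product; have := metric_triangle z x y; lra. Qed.

End GromovProduct.

(** * Rays in hyperbolic spaces *)

Section Hyperbolic.
Variables (R : realType) (X : metricType R) (delta : R).
Hypothesis hyp : delta_hyperbolic X delta.
Implicit Types w x y z : X.
Local Notation gp := (@gromov_product R X).

Lemma hyperbolic_or w x y z :
  gp w x y <= gp w x z + delta \/ gp w y z <= gp w x z + delta.
Proof.
by have := hyp w x y z; rewrite lerBlDr ge_min => /orP.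
Qed.

Lemma hyperbolic_exclude w x y z c :
  gp w x z <= c -> c + delta < gp w y z -> gp w x y <= c + delta.
Proof. by case: (hyperbolic_or w x y z) => *; lra. Qed.

(** The ultrametric inequality along three steps; the middle points are usually
far out on rays, where products with neighbours are large. *)
Lemma hyperbolic_chain w x y z t c : 0 <= delta ->
  c <= gp w x y -> c <= gp w y z -> c <= gp w z t -> c - 2 * delta <= gp w x t.
Proof.
move=> d0 xy yz zt.
case: (hyperbolic_or w x y t) => ?; first lra.
case: (hyperbolic_or w y z t) => ?; lra.
Qed.

(** As in a tree, the point z of a geodesic from x to y at distance (y|w)_x from
x is almost nearest to w. The tolerance 1 allows rounding that distance to an
integer. *)
Lemma near_geodesic w x y z : mdist x y = mdist x z + mdist z y ->
  0 <= delta -> `|mdist x z - gp x y w| <= 1 ->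
  mdist w z <= gp w x y + 2 * delta + 1.
Proof.
move=> xzy d0; rewrite ler_norml => /andP[].
rewrite /gromov_product => l1 l2.
have [] := hyperbolic_or z x w y; rewrite /gromov_product;
  rewrite ?(metric_sym y z) ?(metric_sym w z) ?(metric_sym w y) ?(metric_sym w x);
  move: l1 l2; rewrite ?(metric_sym y x) ?(metric_sym w x) ?(metric_sym w z) xzy;
  lra.
Qed.

Lemma ray_dist0 (r : geodesic_ray X) t : 0 <= t -> mdist (r t) (r 0) = t.
Proof. by move=> t0; rewrite ray_isometric// subr0 ger0_norm. Qed.

Lemma gromov_product_ray (r : geodesic_ray X) s t : 0 <= s <= t ->
  gp (r 0) (r s) (r t) = s.
Proof.
case/andP=> s0 st; have t0 : 0 <= t by lra.
by rewrite /gromov_product !ray_dist0// ray_isometric// distrC ger0_norm; lra.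
Qed.

(** Seen from w, the points q and r t are both at distance about t, and their
product is about t by the chain q, y, r n, r t. *)
Lemma fellow_travel (r : geodesic_ray X) w q y (t n H A : R) : 0 <= delta ->
  0 <= t <= n -> mdist w (r 0) <= H -> mdist y (r n) <= A ->
  mdist w q = t -> mdist w y = t + mdist q y ->
  mdist q (r t) <= 3 * H + 2 * A + 4 * delta.
Proof.
move=> d0 /andP[t0 tn] wH yA wq wqy; have n0 : 0 <= n by lra.
have H0 : 0 <= H by exact: le_trans (mdist_ge0 _ _) wH.
have A0 : 0 <= A by exact: le_trans (mdist_ge0 _ _) yA.
have qy : t - H - A <= gp w q y.
  by rewrite /gromov_product (metric_sym q w) (metric_sym y w) wqy wq; lra.
have yr : t - H - A <= gp w y (r n).
  rewrite /gromov_product; have := metric_triangle (r n) y w.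
  have := metric_triangle (r n) w (r 0); rewrite ray_dist0// (metric_sym (r n) y).
  lra.
have rr : t - H - A <= gp w (r n) (r t).
  have := gromov_product_move_base (r 0) w (r n) (r t).
  rewrite (metric_sym (r 0)) gromov_productC gromov_product_ray ?t0//.
  lra.
have := hyperbolic_chain d0 qy yr rr; rewrite /gromov_product.
have := metric_triangle (r t) (r 0) w; rewrite ray_dist0// (metric_sym (r 0)).
rewrite (metric_sym q w) wq; lra.
Qed.

(** If products between points of c and c' were unbounded, then at each time t the
two rays could be compared through points far out on both of them, and c t would
stay near c' t. *)
Lemma nonasymptotic_bounded (c c' : geodesic_ray X) w : 0 <= delta ->
  ~~ asymptotic c c' ->
  exists K, forall s t, 0 <= s -> 0 <= t -> gp w (c s) (c' t) <= K.
Proof.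
move=> d0 /negP nas; apply: contrapT => /forallNP unb; apply: nas.
apply/asboolP.
pose h := mdist (c 0) (c' 0); have h0 : 0 <= h by exact: mdist_ge0.
exists (5 * h + 4 * delta) => t t0.
have /existsNP[s' /existsNP[t' /not_implyP[s0 /not_implyP[t'0 /negP]]]] :=
  unb (t + mdist w (c 0)).
rewrite -ltNge => big.
have st : t <= gp (c 0) (c s') (c' t').
  by have := gromov_product_move_base w (c 0) (c s') (c' t'); lra.
(* The product is at most the distance to the base point, so s' is at least t. *)
have cc : t <= gp (c 0) (c t) (c s').
  rewrite gromov_product_ray// t0/=; move: st; rewrite /gromov_product ray_dist0//.
  have := metric_triangle (c' t') (c s') (c 0).
  rewrite ray_dist0// (metric_sym (c' t') (c s')); lra.
have cc' : t - 2 * h <= gp (c 0) (c' t') (c' t).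
  have := gromov_product_move_base (c' 0) (c 0) (c' t') (c' t).
  have := metric_triangle (c' t') (c' 0) (c 0).
  have := metric_triangle (c' t') (c s') (c 0).
  rewrite !ray_dist0// (metric_sym (c' 0)) -/h.
  move: st; rewrite /gromov_product !ray_dist0// (ray_isometric c')//.
  have := metric_triangle (c s') (c' t') (c 0).
  rewrite ray_dist0// (metric_sym (c' t') (c s')).
  case: (leP t t') => tt; [rewrite ger0_norm|rewrite ltr0_norm]; lra.
have h1 : t - 2 * h <= gp (c 0) (c t) (c s') by lra.
have h2 : t - 2 * h <= gp (c 0) (c s') (c' t') by lra.
have := hyperbolic_chain d0 h1 h2 cc'; rewrite /gromov_product ray_dist0//.
have := metric_triangle (c' t) (c' 0) (c 0).
rewrite ray_dist0// (metric_sym (c' 0)) -/h; lra.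
Qed.

Lemma asymptotic_nat (c c' : geodesic_ray X) K :
  (forall n : nat, mdist (c n%:R) (c' n%:R) <= K) -> asymptotic c c'.
Proof.
move=> cK; apply/asboolP; exists (K + 2) => t t0.
have /andP[n1 n2] := truncn_itv t0.
set n := Num.truncn t in n1 n2; rewrite -natr1 in n2.
have := metric_triangle (c t) (c n%:R) (c' t).
have := metric_triangle (c n%:R) (c' n%:R) (c' t).
have := cK n; rewrite !ray_isometric// distrC ger0_norm; lra.
Qed.

Lemma endpoint_asymptotic (c c' : geodesic_ray X) :
  endpoint c = endpoint c' <-> asymptotic c c'.
Proof. by split=> [/eqmodP|h]; last apply/eqmodP. Qed.

End Hyperbolic.

(** * Combinatorial distance and shortest walks *)

Section GraphDistance.
Variable G : graph.
Implicit Types u v w : vertex G.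
Local Notation adj := (joined_by_edge (@src G) (@tgt G)).

Lemma adjC u v : adj u v = adj v u.
Proof.
by apply/asboolP/asboolP => -[e [[]|[]]] *; exists e;
  [right|left|right|left].
Qed.

Definition walk (n : nat) u v :=
  exists p, [/\ size p = n, path adj u p & last u p = v].

Lemma walk_exists u v : exists n, `[< walk n u v >].
Proof.
have [p up pv] := graph_connected u v.
by exists (size p); apply/asboolP; exists p.
Qed.

Definition gdist u v := ex_minn (walk_exists u v).

Lemma gdist_walk u v : walk (gdist u v) u v.
Proof. by rewrite /gdist; case: ex_minnP => n /asboolP. Qed.

Lemma gdist_le n u v : walk n u v -> (gdist u v <= n)%N.
Proof. by move=> /asboolP w; rewrite /gdist; case: ex_minnP => m _; apply. Qed.

Lemma gdistxx u : gdist u u = 0%N.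
Proof. by apply/eqP; rewrite -leqn0; apply: gdist_le; exists [::]. Qed.

Lemma gdist_triangle v u w : (gdist u w <= gdist u v + gdist v w)%N.
Proof.
have [p [<- up pv]] := gdist_walk u v; have [q [<- vq qw]] := gdist_walk v w.
by apply: gdist_le; exists (p ++ q); rewrite size_cat cat_path last_cat pv up.
Qed.

Lemma gdistC u v : gdist u v = gdist v u.
Proof.
wlog suff : u v / (gdist u v <= gdist v u)%N.
  by move=> h; apply/eqP; rewrite eqn_leq !h.
have [p [<- vp pu]] := gdist_walk v u.
apply: gdist_le; exists (rev (belast v p)); split.
- by rewrite size_rev size_belast.
- by rewrite -pu rev_path; under eq_path do rewrite adjC.
- by case: p {vp} pu => [|x p] //= _; rewrite rev_cons last_rcons.
Qed.

Lemma adj_gdist u v : adj u v -> (gdist u v <= 1)%N.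
Proof. by move=> uv; apply: gdist_le; exists [:: v]; rewrite /= uv. Qed.

Lemma gdist1_adj u v : gdist u v = 1%N -> adj u v.
Proof.
move=> uv; have := gdist_walk u v; rewrite uv.
by case=> -[|x [|? ?]] [] //= _; rewrite andbT => ux <-.
Qed.

Lemma shortest_walk u v : exists f : nat -> vertex G,
  [/\ f 0%N = u, f (gdist u v) = v &
   forall i j, (i <= j <= gdist u v)%N -> gdist (f i) (f j) = (j - i)%N].
Proof.
have [p [sp up pv]] := gdist_walk u v.
pose f := nth u (u :: p); exists f.
have f0 : f 0%N = u by [].
have fn : f (gdist u v) = v by rewrite -sp -pv /f nth_last.
split=> // i j /andP[ij jn].
have step a k : (a + k <= gdist u v)%N -> (gdist (f a) (f (a + k)) <= k)%N.
  elim: k => [|k IH] ak; first by rewrite addn0 gdistxx.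
  rewrite (leq_trans (gdist_triangle (f (a + k)) _ _))//.
  rewrite -[leqRHS]addn1 leq_add ?IH ?adj_gdist//; first by lia.
  by rewrite addnS; move/(pathP u): up; apply; lia.
have h1 := step 0%N i ltac:(lia); have h2 := step i (j - i)%N ltac:(lia).
have h3 := step j (gdist u v - j)%N ltac:(lia).
rewrite add0n f0 in h1; rewrite subnKC// in h2; rewrite subnKC// fn in h3.
have := gdist_triangle (f i) u v; have := gdist_triangle (f j) (f i) v.
lia.
Qed.

Lemma gdist_ball_finite u n : bounded_valence G ->
  finite_set [set v | (gdist u v <= n)%N].
Proof.
move=> [N bN].
have nbr w : finite_set [set v | adj w v].
  have fin : finite_set [set e : edge G | src e = w \/ tgt e = w].
    exact: card_le_finite (bN w) (finite_II N).
  apply: (@sub_finite_set _ _ ((@src G @` [set e | src e = w \/ tgt e = w])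
    `|` (@tgt G @` [set e | src e = w \/ tgt e = w]))); last first.
    by rewrite finite_setU; split; exact: finite_image.
  move=> v /asboolP[e [[ew ev]|[ev ew]]].
    by right; exists e => //; left.
  by left; exists e => //; right.
elim: n => [|n IH].
  apply: (@sub_finite_set _ _ [set u]) (finite_set1 u) => v /=.
  rewrite leqn0 => /eqP uv; have := gdist_walk u v; rewrite uv.
  by case=> p [/size0nil-> _ <-].
apply: (@sub_finite_set _ _ (\bigcup_(w in [set w | (gdist u w <= n)%N])
  ([set w] `|` [set v | adj w v]))).
  move=> v /=; rewrite leq_eqVlt => /predU1P[uv|uv]; last by exists v => //; left.
  have [f [f0 fv fd]] := shortest_walk u v.
  have fn := fd 0%N n ltac:(lia); have fn1 := fd n n.+1 ltac:(lia).
  exists (f n) => /=; first by rewrite -f0 fn; lia.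
  by right; apply: gdist1_adj; rewrite -fv uv fn1; lia.
by apply: bigcup_finite => // w _; rewrite finite_setU.
Qed.

End GraphDistance.

(** * The path metric and the combinatorial distance *)

Section GraphGeodesics.
Variables (R : realType) (G : graph).
Implicit Types u v w : vertex G.
Local Notation X := (realization R G).
Local Notation pt := (@vertex_point R G).

Lemma gdist_src_tgt u (e : edge G) :
  (gdist u (src e) <= gdist u (tgt e) + 1)%N /\
  (gdist u (tgt e) <= gdist u (src e) + 1)%N.
Proof.
have a : joined_by_edge (@src G) (@tgt G) (src e) (tgt e).
  by apply/asboolP; exists e; left.
have := adj_gdist a; have := gdist_triangle (src e) u (tgt e).
by have := gdist_triangle (tgt e) u (src e); rewrite (gdistC (tgt e)); lia.
Qed.

(** The combinatorial distance to u extends over the edges to a function that is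
1-Lipschitz along each edge, hence for the path metric. *)
Lemma gdist_le_path_dist u v : (gdist u v)%:R <= path_dist (pt u) (pt v).
Proof.
pose g e (t : R) : R :=
  Num.min ((gdist u (src e))%:R + t) ((gdist u (tgt e))%:R + (1 - t)).
pose f (p : X) : R := match p with
  | inl w => (gdist u w)%:R
  | inr (e, s) => g e (val s) end.
have st e : (gdist u (src e))%:R <= (gdist u (tgt e))%:R + 1 :> R /\
            (gdist u (tgt e))%:R <= (gdist u (src e))%:R + 1 :> R.
  have [s t] := gdist_src_tgt u e.
  by split; rewrite natr1 -addn1 ler_nat.
have fE e t : 0 <= t <= 1 -> f (edge_point e t) = g e t.
  rewrite /g; have [s1 s2] := st e.
  case/(@edge_pointP R G e) => [[-> ->]|[-> ->]|[s <- ->//]] /=.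
    by rewrite min_l; lra.
  by rewrite min_r; lra.
have : `|f (pt u) - f (pt v)| <= path_dist (pt u) (pt v).
  apply: lipschitz_path_dist => e s t s01 t01; rewrite !fE// /g ler_norml.
  move: (gdist u (src e))%:R (gdist u (tgt e))%:R => a b.
  case: (leP (a + s) (b + (1 - s))) => ?; case: (leP (a + t) (b + (1 - t))) => ?;
    case: (ger0P (s - t)) => ?; apply/andP; split; lra.
rewrite /= gdistxx sub0r normrN ger0_norm//.
Qed.

Lemma polyline_adj u v : joined_by_edge (@src G) (@tgt G) u v ->
  polyline (pt u) (pt v) (1 : R).
Proof.
have h e : polyline (pt (src e)) (pt (tgt e)) (1 : R).
  rewrite -edge_point0 -edge_point1 -[X in polyline _ _ X](normr1 R).
  by rewrite -normrN -sub0r; apply: polyline_segment; rewrite lexx ler01.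
by case/asboolP=> e [[<- <-]|[<- <-]]; [|apply: polyline_sym].
Qed.

Lemma mdist_vertex u v : mdist (pt u) (pt v) = (gdist u v)%:R.
Proof.
apply/eqP; rewrite eq_le gdist_le_path_dist andbT.
apply: path_dist_le; have [p [<- + <-]] := gdist_walk u v.
elim: p u {v} => [|w p IH] u /=; first by constructor.
case/andP=> /polyline_adj uw /IH wp.
by rewrite -nat1r; exact: polyline_cat uw wp.
Qed.

Lemma near_vertex (x : X) : exists v, mdist x (pt v) <= 1.
Proof.
case: x => [v|[e s]]; first by exists v; rewrite mdistxx.
exists (src e); rewrite -edge_point0 -edge_point_inner.
have /andP[/= s0 s1] := valP s.
have := @polyline_segment R G e (val s) 0 ltac:(rewrite !ltW//)
  ltac:(by rewrite lexx ler01).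
by move=> /path_dist_le /le_trans; apply; rewrite subr0 ger0_norm ltW.
Qed.

Lemma geodesic_edge u v : gdist u v = 1%N ->
  exists h : R -> X, [/\ h 0 = pt u, h 1 = pt v &
    forall s t, 0 <= s <= 1 -> 0 <= t <= 1 -> mdist (h s) (h t) <= `|s - t|].
Proof.
move=> /gdist1_adj/asboolP[e [[<- <-]|[<- <-]]].
  exists (edge_point e); rewrite edge_point0 edge_point1; split=> // s t s01 t01.
  by apply: path_dist_le; exact: polyline_segment.
exists (fun t => edge_point e (1 - t)).
rewrite subr0 subrr edge_point0 edge_point1; split=> // s t s01 t01.
have -> : `|s - t| = `|(1 - s) - (1 - t)| by rewrite distrC; congr `|_|; lra.
by apply: path_dist_le; apply: polyline_segment; lra.
Qed.

(** The interpolation is 1-Lipschitz and isometric on the integers. A 1-Lipschitz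
path between points as far apart as its duration is isometric in between. *)
Lemma realize_line (g : int -> vertex G) :
  (forall i j, mdist (pt (g i)) (pt (g j)) = `|i%:~R - j%:~R|) ->
  exists c : geodesic_line X, forall i : int, c i%:~R = pt (g i).
Proof.
move=> gd.
have /choice[h hP] i : exists h : R -> X,
    [/\ h 0 = pt (g i), h 1 = pt (g (i + 1)) &
    forall s t, 0 <= s <= 1 -> 0 <= t <= 1 -> mdist (h s) (h t) <= `|s - t|].
  apply: geodesic_edge; apply/eqP; rewrite -(eqr_nat R) -mdist_vertex gd.
  by rewrite intrD opprD addNKr normrN normr1.
pose c (t : R) := h (Num.floor t) (t - (Num.floor t)%:~R).
have frac (t : R) : 0 <= t - (Num.floor t)%:~R <= 1.
  by have := floor_itv t; rewrite intrD; lra.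
have cE i : c i%:~R = pt (g i).
  by rewrite /c intrKfloor subrr; have [-> _ _] := hP i.
have left_end (t : R) : mdist (pt (g (Num.floor t))) (c t) <= t - (Num.floor t)%:~R.
  have [<- _ h1] := hP (Num.floor t); have := frac t => /andP[f0 f1].
  by rewrite (le_trans (h1 _ _ _ _)) ?lexx ?ler01 ?f0// sub0r normrN ger0_norm.
have right_end (t : R) : mdist (c t) (pt (g (Num.floor t + 1))) <=
    (Num.floor t + 1)%:~R - t.
  have [_ <- h1] := hP (Num.floor t); have := frac t => /andP[f0 f1].
  rewrite (le_trans (h1 _ _ _ _)) ?lexx ?ler01 ?f0// intrD.
  by rewrite distrC ger0_norm; lra.
have lip (s t : R) : s <= t -> mdist (c s) (c t) <= t - s.
  move=> st; have := le_floor st; rewrite le_eqVlt => /predU1P[fst|fst].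
    rewrite /c -fst; have [_ _ h1] := hP (Num.floor s).
    have := frac s; have := frac t; rewrite -fst => ft fs.
    by rewrite (le_trans (h1 _ _ _ _))// distrC ger0_norm; lra.
  have fl : (Num.floor s + 1)%:~R <= (Num.floor t)%:~R :> R by rewrite ler_int; lia.
  have := left_end t; have := right_end s.
  have := metric_triangle (c s) (pt (g (Num.floor s + 1))) (c t).
  have := metric_triangle (pt (g (Num.floor s + 1))) (pt (g (Num.floor t))) (c t).
  by rewrite gd distrC ger0_norm; lra.
have iso (s t : R) : s <= t -> mdist (c s) (c t) = t - s.
  move=> st; apply/eqP; rewrite eq_le lip//=.
  have := left_end s; have := right_end t.
  have := metric_triangle (pt (g (Num.floor s))) (c s) (pt (g (Num.floor t + 1))).
  have := metric_triangle (c s) (c t) (pt (g (Num.floor t + 1))).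
  rewrite gd distrC ger0_norm; first lra.
  by rewrite subr_ge0 ler_int; have := le_floor st; lia.
have isom (s t : R) : mdist (c s) (c t) = `|s - t|.
  case: (leP s t) => [st|/ltW st]; first by rewrite iso// distrC ger0_norm// subr_ge0.
  by rewrite metric_sym iso// ger0_norm// subr_ge0.
by exists (GeodesicLine isom).
Qed.

End GraphGeodesics.

(** * Limits of geodesics and lines between boundary points *)

(** An ultrafilter refining eventuality selects one value of each coordinate. Two
coordinates at a time suffice, as being isometric is a condition on pairs. *)
Lemma diagonal_limit (I : Type) (T : choiceType) (f : nat -> I -> T)
    (A : I -> set T) :
  (forall i, finite_set (A i)) ->
  (forall i, exists N, forall n, (N <= n)%N -> A i (f n i)) ->
  exists g : I -> T, forall i j N,
    exists n, [/\ (N <= n)%N, f n i = g i & f n j = g j].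
Proof.
move=> finA fA; have [U [UU ooU]] := ultraFilterLemma (F := \oo) _.
have /choice[g gU] i : exists a, U [set n | f n i = a].
  apply: contrapT => /forallNP noa.
  have Uneq a : U (~` [set n | f n i = a]).
    by have [/noa|//] := in_ultra_setVsetC [set n | f n i = a] UU.
  have UA : U [set n | A i (f n i)].
    by apply: ooU; have [N AN] := fA i; exists N.
  have Uall : U (\bigcap_(a in [set` fset_set (A i)]) ~` [set n | f n i = a]).
    by apply: filter_bigI.
  have [n [/= An /(_ (f n i))]] := filter_ex (filterI UA Uall).
  by apply=> //=; rewrite in_fset_set// inE.
exists g => i j N.
have UN : U [set n | (N <= n)%N] by apply: ooU; exists N.
by have [n [Nn [ni nj]]] := filter_ex (filterI UN (filterI (gU i) (gU j))); exists n.
Qed.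

Section Lines.
Variables (R : realType) (G : graph) (delta : R).
Hypothesis d0 : 0 <= delta.
Hypothesis hyp : delta_hyperbolic (realization R G) delta.
Implicit Types u v w : vertex G.
Local Notation X := (realization R G).
Local Notation pt := (@vertex_point R G).
Local Notation gp := (@gromov_product R X).

(** Shortest walks are parametrized so that time 0 is near u. This is what keeps a
sequence of them, with ends going to infinity, from escaping. *)
Lemma centered_segment x y u K : gp (pt u) (pt x) (pt y) <= K ->
  exists (f : int -> vertex G) (a b : nat), [/\ f (- a%:Z) = x, f b%:Z = y,
    mdist (pt u) (pt (f 0)) <= K + 2 * delta + 1 &
    forall i j : int, - a%:Z <= i <= b%:Z -> - a%:Z <= j <= b%:Z ->
      mdist (pt (f i)) (pt (f j)) = `|i%:~R - j%:~R|].
Proof.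
move=> xyK; have [w [w0 wn wd]] := shortest_walk x y.
set m := gdist x y in wn wd *; pose k := Num.truncn (gp (pt x) (pt y) (pt u)).
have gp0 : 0 <= gp (pt x) (pt y) (pt u).
  have := metric_triangle (pt y) (pt x) (pt u); rewrite /gromov_product.
  by rewrite (metric_sym (pt x) (pt u)); lra.
have /andP[k1 k2] := truncn_itv gp0.
rewrite -/k in k1 k2; rewrite -natr1 in k2.
have km : (k <= m)%N.
  rewrite -(ler_nat R) (le_trans k1)// -mdist_vertex /gromov_product.
  have := metric_triangle (pt u) (pt y) (pt x).
  by rewrite (metric_sym (pt y) (pt x)) (metric_sym (pt y) (pt u)); lra.
exists (fun i : int => w (absz (k%:Z + i))), k, (m - k)%N; split.
- by rewrite subrr.
- by rewrite -wn; congr w; lia.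
- have dk : mdist (pt x) (pt (w k)) = k%:R.
    by rewrite mdist_vertex -[in LHS]w0 wd ?subn0 ?km.
  have dkm : mdist (pt (w k)) (pt y) = (m - k)%:R.
    by rewrite mdist_vertex -[in LHS]wn wd ?km ?leqnn.
  rewrite addr0 absz_nat.
  have xzy : mdist (pt x) (pt y) = mdist (pt x) (pt (w k)) + mdist (pt (w k)) (pt y).
    by rewrite dk dkm mdist_vertex -natrD subnKC.
  have kn : `|mdist (pt x) (pt (w k)) - gp (pt x) (pt y) (pt u)| <= 1.
    by rewrite dk ler_norml; lra.
  by rewrite (le_trans (near_geodesic hyp xzy d0 kn))//; lra.
- move=> i j i1 j1; wlog ij : i j i1 j1 / i <= j.
    move=> h; case: (lerP i j) => [|/ltW] ij; first exact: h.
    by rewrite metric_sym distrC h.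
  rewrite mdist_vertex wd; last by lia.
  rewrite -intrB -intr_norm pmulrn; congr (_%:~R); lia.
Qed.

Lemma nat_above (x : R) : exists N : nat, x <= N%:R.
Proof. by exists (Num.truncn x).+1; apply/ltW/truncnS_gt. Qed.

(** The visibility property of proper hyperbolic spaces. The line is a limit of
segments between vertices near r n and r' n, all passing near a fixed vertex. *)
Lemma line_joining_boundary (xi eta : geodesic_boundary X) :
  bounded_valence G -> xi <> eta -> exists c, line_joins c xi eta.
Proof.
move=> bv xieta; pose r := repr xi; pose r' := repr eta.
have rE : endpoint r = xi by rewrite /endpoint reprK.
have r'E : endpoint r' = eta by rewrite /endpoint reprK.
have nas : ~~ asymptotic r r'.
  by apply/negP => /endpoint_asymptotic; rewrite rE r'E.
have [u hu] := near_vertex (r 0).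
have [K hK] := nonasymptotic_bounded hyp (pt u) d0 nas.
have /choice[x hx] (n : nat) := near_vertex (r (n%:R : R)).
have /choice[y hy] (n : nat) := near_vertex (r' n%:R).
have xyK n : gp (pt u) (pt (x n)) (pt (y n)) <= K + 2.
  have h1 := gromov_product_move (pt u) (pt (x n)) (r n%:R) (pt (y n)).
  have h2 := gromov_product_move (pt u) (pt (y n)) (r' n%:R) (r n%:R).
  rewrite (gromov_productC _ (r n%:R)) (metric_sym (pt (x n))) in h1.
  rewrite (gromov_productC _ (r' n%:R)) (metric_sym (pt (y n))) in h2.
  have := hK n%:R n%:R (ler0n _ _) (ler0n _ _); have := hx n; have := hy n; lra.
have /choice[f hf] n := centered_segment (xyK n).
have /choice[a ha] n := hf n; have /choice[b hb] n := ha n.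
pose K' := K + 2 + 2 * delta + 1; pose H := K' + 1 + mdist (pt u) (r' 0).
have f0H n : mdist (pt (f n 0)) (r 0) <= H.
  have [_ _ uK _] := hb n.
  have := metric_triangle (pt (f n 0)) (pt u) (r 0).
  rewrite (metric_sym (pt (f n 0)) (pt u)) (metric_sym (pt u) (r 0)).
  by have := mdist_ge0 (pt u) (r' 0); rewrite /H /K'; lra.
have f0H' n : mdist (pt (f n 0)) (r' 0) <= H.
  have [_ _ uK _] := hb n.
  have := metric_triangle (pt (f n 0)) (pt u) (r' 0).
  by rewrite (metric_sym (pt (f n 0)) (pt u)) /H /K'; lra.
have zero_in n : - (a n)%:Z <= 0 <= (b n)%:Z by lia.
(* Both halves of the n-th segment have length at least n, up to a constant. *)
have a_large n : n%:R - H - 1 <= (a n)%:R.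
  have [fa fb _ fd] := hb n; have := fd (- (a n)%:Z) 0 ltac:(lia) (zero_in n).
  rewrite fa subr0 mulrNz normrN ger0_norm// -pmulrn => <-.
  have := metric_triangle (r n%:R) (pt (x n)) (r 0); rewrite ray_dist0//.
  by have := metric_triangle (pt (x n)) (pt (f n 0)) (r 0);
    have := f0H n; have := hx n; lra.
have b_large n : n%:R - H - 1 <= (b n)%:R.
  have [fa fb _ fd] := hb n; have := fd (b n)%:Z 0 ltac:(lia) (zero_in n).
  rewrite fb subr0 ger0_norm// -pmulrn => <-.
  have := metric_triangle (r' n%:R) (pt (y n)) (r' 0); rewrite ray_dist0//.
  by have := metric_triangle (pt (y n)) (pt (f n 0)) (r' 0);
    have := f0H' n; have := hy n; lra.
have inside (i : int) : exists N, forall n, (N <= n)%N ->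
    - (a n)%:Z <= i <= (b n)%:Z.
  have [N hN] := nat_above (`|i|%N%:R + H + 1); exists N => n.
  rewrite -(ler_nat R) => Nn.
  have an : (`|i| <= a n)%N by rewrite -(ler_nat R); have := a_large n; lra.
  have bn : (`|i| <= b n)%N by rewrite -(ler_nat R); have := b_large n; lra.
  lia.
pose A (i : int) := [set v | mdist (pt u) (pt v) <= `|i%:~R| + K'].
have finA i : finite_set (A i).
  have [N hN] := nat_above (`|i%:~R| + K').
  apply: (sub_finite_set _ (gdist_ball_finite u N bv)) => v /=.
  by rewrite /A/= mdist_vertex => h; rewrite -(ler_nat R) (le_trans h).
have fA i : exists N, forall n, (N <= n)%N -> A i (f n i).
  have [N hN] := inside i; exists N => n /hN iab; have [_ _ uK fd] := hb n.
  rewrite /A/= (le_trans (metric_triangle _ (pt (f n 0)) _))// addrC lerD//.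
  by rewrite fd// sub0r normrN.
have [g hg] := diagonal_limit finA fA.
(* Each pair of limit values is already attained on a segment that is long
   enough to contain both times. *)
have [i j|c hc] := @realize_line R G g.
  have [N1 h1] := inside i; have [N2 h2] := inside j.
  have [n [Nn <- <-]] := hg i j (maxn N1 N2).
  by have [_ _ _ ->] := hb n; rewrite ?h1 ?h2//; lia.
exists c; rewrite /line_joins -{1}rE -{1}r'E.
split; apply/endpoint_asymptotic;
  apply: (@asymptotic_nat _ _ _ _ (3 * H + 2 * 1 + 4 * delta)) => k /=.
- have [N hN] := inside (- k%:Z).
  have [n [nN gn _]] := hg (- k%:Z) 0 (maxn k N).
  have [fa fb _ fd] := hb n; have kab := hN n ltac:(lia).
  have -> : - k%:R = (- k%:Z)%:~R :> R by rewrite mulrNz.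
  rewrite hc -gn.
  have kn : 0 <= (k%:R : R) <= n%:R by rewrite ler0n ler_nat; lia.
  have yA : mdist (pt (x n)) (r n%:R) <= 1 by rewrite metric_sym.
  apply: (fellow_travel hyp d0 kn (f0H n) yA).
    by rewrite fd// sub0r mulrNz opprK ger0_norm.
  rewrite -fa !fd//; try lia.
  have ka : (k%:Z)%:~R <= (a n)%:~R :> R by rewrite ler_int; lia.
  rewrite sub0r !mulrNz !opprK ger0_norm// ger0_norm; first by rewrite -pmulrn; lra.
  lra.
- have [N hN] := inside k%:Z.
  have [n [nN gn _]] := hg k%:Z 0 (maxn k N).
  have [fa fb _ fd] := hb n; have kab := hN n ltac:(lia).
  rewrite -[k%:R]/((k%:Z)%:~R) hc -gn.
  have kn : 0 <= (k%:R : R) <= n%:R by rewrite ler0n ler_nat; lia.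
  have yA : mdist (pt (y n)) (r' n%:R) <= 1 by rewrite metric_sym.
  apply: (fellow_travel hyp d0 kn (f0H' n) yA).
    by rewrite fd// sub0r normrN ger0_norm.
  rewrite -fb !fd//; try lia.
  have kb : (k%:Z)%:~R <= (b n)%:~R :> R by rewrite ler_int; lia.
  rewrite sub0r normrN ger0_norm// distrC ger0_norm; first by rewrite -!pmulrn; lra.
  lra.
Qed.

End Lines.

(** * Branching at every vertex *)

(** Opposite far ends of a line have product at most D from any point within D of
the line. Replacing the ends by points of asymptotic rays costs delta
twice, whatever the distance between line and rays is, provided T is large. *)
Lemma ray_ends_apart (R : realType) (X : metricType R) (delta D : R)
    (c : geodesic_line X) (r r' : geodesic_ray X) (p : X) t0 :
  0 <= delta -> delta_hyperbolic X delta -> mdist p (c t0) <= D ->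
  asymptotic (negative_ray c) r -> asymptotic (positive_ray c) r' ->
  exists T0, forall T, T0 <= T -> gromov_product p (r T) (r' T) <= D + 2 * delta.
Proof.
move=> d0 hyp pD /asboolP[K1 rK1] /asboolP[K2 rK2].
have K10 : 0 <= K1 by exact: le_trans (mdist_ge0 _ _) (rK1 0 (lexx 0)).
have K20 : 0 <= K2 by exact: le_trans (mdist_ge0 _ _) (rK2 0 (lexx 0)).
have D0 : 0 <= D by exact: le_trans (mdist_ge0 _ _) pD.
exists (`|t0| + 2 * D + K1 + K2 + 2 * delta + 1) => T TT.
have t0T : `|t0| <= T by lra.
have T0 : 0 <= T by exact: le_trans (normr_ge0 _) t0T.
have [nt0 t0n] : - `|t0| <= t0 /\ t0 <= `|t0|.
  by split; [rewrite lerNnormlW|exact: ler_norm].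
have cc : gromov_product p (c (- T)) (c T) <= D.
  apply: (le_trans (gromov_product_move_base _ (c t0) _ _)).
  rewrite /gromov_product !line_isometric.
  rewrite [ `|- T - t0|]ler0_norm ?[ `|T - t0|]ger0_norm ?[ `|- T - T|]ler0_norm; lra.
have far s : `|s - t0| - D <= mdist (c s) p.
  have := metric_triangle (c s) p (c t0); rewrite line_isometric; lra.
have h1 : T - `|t0| - D - K1 <= gromov_product p (c (- T)) (r T).
  rewrite /gromov_product; have := rK1 T T0; rewrite /= => h.
  have := far (- T); rewrite ler0_norm; last lra.
  by have := metric_triangle (c (- T)) (r T) p; lra.
have h2 : T - `|t0| - D - K2 <= gromov_product p (c T) (r' T).
  rewrite /gromov_product; have := rK2 T T0; rewrite /= => h.
  have := far T; rewrite ger0_norm; last lra.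
  by have := metric_triangle (c T) (r' T) p; lra.
have [?|h3] := hyperbolic_or hyp p (c (- T)) (r T) (c T); first lra.
rewrite gromov_productC in h2.
have [?|?] := hyperbolic_or hyp p (r T) (r' T) (c T); lra.
Qed.

Section Branching.
Variables (R : realType) (G : graph) (delta : R).
Implicit Types u v w : vertex G.
Local Notation X := (realization R G).
Local Notation pt := (@vertex_point R G).
Local Notation gp := (@gromov_product R X).

(** The far points that give the directions depend on N and on the rays, but the
bound on their products only involves D and delta. *)
Lemma three_directions (xi : ideal_triple X) (p : X) (D : R) u (N : nat) :
  0 <= delta -> delta_hyperbolic X delta ->
  bounded_valence G -> is_barycenter D xi p -> mdist (pt u) p <= D ->
  exists x : 'I_3 -> vertex G, (forall i, gdist u (x i) = N) /\
    forall i j, i != j ->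
      gp (pt u) (pt (x i)) (pt (x j)) <= 2 * D + 2 * delta + 2.
Proof.
move=> d0 hyp bv bary up; pose r i := repr (xi i).
have rE i : endpoint (r i) = xi i by rewrite /endpoint reprK.
have /choice[T0 hT0] (ij : 'I_3 * 'I_3) : exists T0, ij.1 != ij.2 ->
    forall T, T0 <= T -> gp (pt u) (r ij.1 T) (r ij.2 T) <= 2 * D + 2 * delta.
  case: ij => i j /=; case: (eqVneq i j) => [_|ij]; first by exists 0.
  have [c cij] : exists c, line_joins c (xi i) (xi j).
    apply: (line_joining_boundary d0 hyp bv) => /triple_inj/eqP.
    by rewrite (negbTE ij).
  have [t pt0] := bary i j c ij cij.
  have ut : mdist (pt u) (c t) <= 2 * D.
    by have := metric_triangle (pt u) p (c t); lra.
  have [ci cj] := cij; rewrite -rE in ci; rewrite -rE in cj.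
  have [T0 hT0] := ray_ends_apart d0 hyp ut
    (iffLR (endpoint_asymptotic _ _) ci) (iffLR (endpoint_asymptotic _ _) cj).
  by exists T0.
(* One time T that works for all pairs and is far enough to leave the N-ball. *)
pose T := \sum_ij `|T0 ij| + \sum_i mdist (pt u) (r i 0) + N%:R + 1.
have T0T ij : T0 ij <= T.
  have : `|T0 ij| <= \sum_ij `|T0 ij| by rewrite (bigD1 ij)//= lerDl sumr_ge0.
  have : 0 <= \sum_i mdist (pt u) (r i 0).
    by apply: sumr_ge0 => i _; exact: mdist_ge0.
  by have := ler_norm (T0 ij); have := ler0n R N; rewrite /T; lra.
have T1 i : mdist (pt u) (r i 0) + N%:R + 1 <= T.
  have : mdist (pt u) (r i 0) <= \sum_i mdist (pt u) (r i 0).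
    by rewrite (bigD1 i)//= lerDl sumr_ge0// => j _; exact: mdist_ge0.
  have : 0 <= \sum_ij `|T0 ij| by apply: sumr_ge0.
  by rewrite /T; lra.
have Tge0 : 0 <= T.
  by have := T1 ord0; have := mdist_ge0 (pt u) (r ord0 0); have := ler0n R N; lra.
have /choice[z hz] i := near_vertex (r i T).
have Nz i : (N <= gdist u (z i))%N.
  rewrite -(ler_nat R) -mdist_vertex.
  have := ray_dist0 (r i) Tge0; have := T1 i; have := hz i.
  have := metric_triangle (r i T) (pt (z i)) (r i 0).
  have := metric_triangle (pt (z i)) (pt u) (r i 0).
  by rewrite (metric_sym (pt (z i)) (pt u)); lra.
(* Replacing the points r i T by nearby vertices costs 1 for each of the two. *)
have gpz i j : i != j -> gp (pt u) (pt (z i)) (pt (z j)) <= 2 * D + 2 * delta + 2.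
  move=> ij; have := hT0 (i, j) ij T (T0T _) => /=.
  have h1 := gromov_product_move (pt u) (pt (z i)) (r i T) (pt (z j)).
  have h2 := gromov_product_move (pt u) (pt (z j)) (r j T) (r i T).
  rewrite (gromov_productC _ (r i T)) (metric_sym (pt (z i))) in h1.
  rewrite (gromov_productC _ (r j T)) (metric_sym (pt (z j))) in h2.
  by have := hz i; have := hz j; lra.
have /choice[x hx] i : exists x, gdist u x = N /\
    mdist (pt (z i)) (pt u) = mdist (pt (z i)) (pt x) + mdist (pt x) (pt u).
  have [f [f0 fz fd]] := shortest_walk u (z i).
  have ux : gdist u (f N) = N by rewrite -{1}f0 fd ?subn0//= Nz.
  have xz : gdist (f N) (z i) = (gdist u (z i) - N)%N.
    by rewrite -[in LHS]fz fd// Nz leqnn.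
  exists (f N); split=> //; rewrite !mdist_vertex -natrD.
  by rewrite gdistC (gdistC (z i)) (gdistC (f N) u) ux xz subnK.
exists x; split=> [i|i j ij]; first by have [] := hx i.
have [_ xi_seg] := hx i; have [_ xj_seg] := hx j.
apply: le_trans (gromov_product_segment _ xi_seg) _.
rewrite gromov_productC; apply: le_trans (gromov_product_segment _ xj_seg) _.
by rewrite gromov_productC gpz.
Qed.

(** Two directions that both turn back towards the previous vertex would have a
large product with each other, so at most one of three does. *)
Lemma two_children prev cur (x : 'I_3 -> vertex G) (C : R) :
  delta_hyperbolic X delta ->
  (forall i j, i != j -> gp (pt cur) (pt (x i)) (pt (x j)) <= C) ->
  exists i j, [/\ i != j, gp (pt cur) (pt prev) (pt (x i)) <= C + delta &
    gp (pt cur) (pt prev) (pt (x j)) <= C + delta].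
Proof.
move=> hyp xC.
have two i j : i != j -> gp (pt cur) (pt prev) (pt (x i)) <= C + delta \/
                         gp (pt cur) (pt prev) (pt (x j)) <= C + delta.
  move=> ij; have := hyperbolic_or hyp (pt cur) (pt (x i)) (pt prev) (pt (x j)).
  rewrite (gromov_productC _ (pt (x i)) (pt prev)).
  by have := xC _ _ ij => ? [] ?; [left|right]; lra.
pose i0 : 'I_3 := inord 0; pose i1 : 'I_3 := inord 1; pose i2 : 'I_3 := inord 2.
have n01 : i0 != i1 by rewrite -val_eqE /= !inordK.
have n02 : i0 != i2 by rewrite -val_eqE /= !inordK.
have n12 : i1 != i2 by rewrite -val_eqE /= !inordK.
have [h0|h1] := two i0 i1 n01.
  by have [h|h] := two i1 i2 n12; [exists i0, i1|exists i0, i2].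
by have [h|h] := two i0 i2 n02; [exists i0, i1|exists i1, i2].
Qed.

(** The bound on products with the previous vertex makes the induction work: a
vertex z above the child x l is seen from cur in nearly the same direction as
x l, since N - (x l|z)_cur is the product of cur and z seen from x l. Hence
the two subtrees are disjoint, and neither of them turns back. At the root any
previous vertex will do, for example the root itself. *)
Lemma binary_tree (C : R) (N : nat) :
  0 <= delta -> delta_hyperbolic X delta -> 0 <= C -> 2 * C + 4 * delta < N%:R ->
  (forall u, exists x : 'I_3 -> vertex G, (forall i, gdist u (x i) = N) /\
    forall i j, i != j -> gp (pt u) (pt (x i)) (pt (x j)) <= C) ->
  forall k prev cur, exists s : seq (vertex G), [/\ uniq s, size s = (2 ^ k)%N &
    forall z, z \in s -> (gdist cur z <= k * N)%N /\
      gp (pt cur) (pt prev) (pt z) <= C + 2 * delta].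
Proof.
move=> d0 hyp C0 NC tri; elim=> [|k IH] prev cur.
  exists [:: cur]; split=> // z; rewrite inE => /eqP->; rewrite gdistxx; split=> //.
  by rewrite gromov_productC gromov_product_base; lra.
have [x [xN xC]] := tri cur.
have [i [j [ij pi pj]]] := two_children prev hyp xC.
have [s [us ss hs]] := IH cur (x i); have [s' [us' ss' hs']] := IH cur (x j).
have away l z : gp (pt (x l)) (pt cur) (pt z) <= C + 2 * delta ->
    N%:R - (C + 2 * delta) <= gp (pt cur) (pt (x l)) (pt z).
  have := mdist_vertex R cur (x l); rewrite xN /gromov_product.
  rewrite (metric_sym (pt (x l)) (pt cur)) (metric_sym (pt z) (pt cur)).
  rewrite (metric_sym (pt z) (pt (x l))); lra.
have step l z : gp (pt cur) (pt prev) (pt (x l)) <= C + delta ->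
    (gdist (x l) z <= k * N)%N /\ gp (pt (x l)) (pt cur) (pt z) <= C + 2 * delta ->
    (gdist cur z <= k.+1 * N)%N /\ gp (pt cur) (pt prev) (pt z) <= C + 2 * delta.
  move=> pl [xz /away az]; split.
    by rewrite mulSn (leq_trans (gdist_triangle (x l) _ _))// xN leq_add2l.
  rewrite gromov_productC in az.
  have -> : C + 2 * delta = C + delta + delta by lra.
  by apply: (hyperbolic_exclude hyp pl); apply: lt_le_trans az; lra.
exists (s ++ s'); rewrite size_cat ss ss' addnn -mul2n -expnS; split=> //.
  rewrite cat_uniq us us' andbT; apply/hasPn => z zs'; apply/negP => zs.
  have [_ /away zi] := hs z zs; have [_ /away zj] := hs' z zs'.
  rewrite (gromov_productC _ (pt (x j))) in zj.
  have : C + delta < gp (pt cur) (pt z) (pt (x j)) by apply: lt_le_trans zj; lra.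
  by move/(hyperbolic_exclude hyp (xC _ _ ij)); apply/negP; rewrite -ltNge;
    apply: lt_le_trans zi; lra.
by move=> z; rewrite mem_cat => /orP[/hs|/hs']; exact: step.
Qed.

End Branching.

(** * Exponential growth *)

Lemma growth_of_trees (R : realType) (G : graph) (N : nat) : (0 < N)%N ->
  bounded_valence G ->
  (forall k (u : vertex G), exists s : seq (vertex G),
    [/\ uniq s, size s = (2 ^ k)%N & forall z, z \in s -> (gdist u z <= k * N)%N]) ->
  exponential_growth R G.
Proof.
move=> N0 bv tree; pose b : R := 2 `^ N%:R^-1.
have bN : b ^+ N = 2.
  by rewrite -powR_mulrn ?powR_ge0// -powRrM mulVf ?powRr1// pnatr_eq0 -lt0n.
have b1 : 1 < b.
  rewrite ltNge; apply/negP => b1; have := exprn_ile1 N (powR_ge0 _ _) b1.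
  by rewrite bN; lra.
exists 2^-1, b; split=> // u n _.
have finB : finite_set (vertex_ball R u n).
  apply: (sub_finite_set _ (gdist_ball_finite u n bv)) => v /=.
  by rewrite /vertex_ball/= mdist_vertex ler_nat.
pose k := (n %/ N)%N; have [s [us ss hs]] := tree k u.
have : (size s <= #|` fset_set (vertex_ball R u n)|)%N.
  apply: uniq_leq_size us _ => z /hs zk.
  rewrite in_fset_set// inE /vertex_ball/= mdist_vertex ler_nat (leq_trans zk)//.
  exact: leq_trunc_div.
rewrite ss -(ler_nat R) => /(le_trans _); apply.
rewrite natrX mulrC ler_pdivrMr// -exprSr -bN -exprM ler_weXn2l ?ltW//.
by rewrite mulnC ltnW// ltn_ceil.
Qed.

Theorem theorem1p7 (R : realType) (G : graph)
    (b : ideal_triple (realization R G) -> realization R G) :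
  gromov_hyperbolic (realization R G) ->
  barycenter_map b ->
  coarsely_surjective b ->
  bounded_valence G ->
  exponential_growth R G.
Proof.
move=> [delta d0 hyp] [D D0 bD] [L L0 bL] bv.
pose C := 2 * (D + L) + 2 * delta + 2; have C0 : 0 <= C by rewrite /C; lra.
have [N NC] := nat_above (2 * C + 4 * delta + 1).
have tri u : exists x : 'I_3 -> vertex G, (forall i, gdist u (x i) = N) /\
    forall i j, i != j -> gromov_product (vertex_point R u)
      (vertex_point R (x i)) (vertex_point R (x j)) <= C.
  have [xi uxi] := bL (vertex_point R u).
  rewrite {}/C in C0 NC *; apply: (@three_directions _ _ _ xi (b xi) (D + L)) => //.
    move=> i j c ij cij; have [t ht] := bD xi i j c ij cij.
    by exists t; rewrite (le_trans ht)// lerDl.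
  by rewrite (le_trans uxi)// lerDr.
have N0 : (0 < N)%N by rewrite -(ltr_nat R); lra.
apply: (@growth_of_trees R G N N0 bv) => k u.
have NC' : 2 * C + 4 * delta < N%:R by lra.
have [s [us ss hs]] := binary_tree d0 hyp C0 NC' tri k u u.
by exists s; split=> // z /hs[].
Qed.
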